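(* Let $(a_n)_{n\ge1}$ be a sequence of real numbers. For each $n\ge 1$ let $p_n(z)=z^n-a_1z^{n-1}-\cdots-a_{n-1}z-a_n$, let $z_1,\ldots,z_n\in\mathbb{C}$ be the $n$ zeros of $p_n$, so that $p_n(z)=(z-z_1)\cdots(z-z_n)$, and let $r_n=\max\{|z|: z\in\mathbb{C},\ p_n(z)=0\}$. If there exists an index $n\ge 1$ such that $r_n>1$ and $$\sum_{i=n+1}^{\infty}|a_i|<\delta_n(\rho_0),$$ where $\rho_0$ is a point that maximizes the function $\delta_n:[r_n^{-1},1]\to\mathbb{R}$ defined by $$\delta_n(\rho)=\big|(1-\rho|z_1|)(1-\rho|z_2|)\cdots(1-\rho|z_n|)\big|,$$ then the null solution of the Volterra difference equation $x_n=\sum_{i=0}^{n-1}a_{n-i}x_i$, $n\ge 1$, is unstable.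
   Context: A solution of the equation $x_n=\sum_{i=0}^{n-1}a_{n-i}x_i$ ($n\ge1$) is the sequence $(x_n)_{n\ge 0}$ generated recursively from an initial condition $x_0\in\mathbb{R}$. The null solution is the one with $x_0=0$. The null solution is stable if for every $\varepsilon>0$ there is $\delta>0$ such that $|x_0|<\delta$ implies $|x_n|<\varepsilon$ for all $n\ge 0$; it is unstable if it is not stable. *)

(* Defs.v *)
From HB Require Import structures.
From mathcomp Require Import all_boot all_order all_algebra.
From mathcomp Require Import complex.
From mathcomp Require Import all_classical all_reals all_analysis.

Set Implicit Arguments.
Unset Strict Implicit.
Unset Printing Implicit Defensive.

Import Order.TTheory GRing.Theory Num.Theory.
Import numFieldNormedType.Exports.

Local Open Scope classical_set_scope.
Local Open Scope ring_scope.
Local Open Scope complex_scope.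

(* A sequence (a_n)_{n >= 1} is a function on nat whose value at 0 is never
   used. *)

Definition volterra_solution (R : realType) (a x : nat -> R) : Prop :=
  forall n : nat, (1 <= n)%N -> x n = \sum_(0 <= i < n) a (n - i)%N * x i.

Definition null_solution_stable (R : realType) (a : nat -> R) : Prop :=
  forall eps : R, 0 < eps ->
    exists2 delta : R, 0 < delta &
      forall x : nat -> R, volterra_solution a x ->
        `|x 0%N| < delta -> forall n : nat, `|x n| < eps.

Definition null_solution_unstable (R : realType) (a : nat -> R) : Prop :=
  ~ null_solution_stable a.

Definition volterra_poly (R : realType) (a : nat -> R) (n : nat) : {poly R[i]} :=
  'X^n - \sum_(1 <= i < n.+1) (a i)%:C *: 'X^(n - i).

(* The norm `|z| on R[i] has values in R[i]; normc is the R-valued modulus. *)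
Definition root_moduli (R : realType) (p : {poly R[i]}) : set R :=
  [set Normc.normc z | z in [set z : R[i] | root p z]].

Definition is_max (R : realType) (A : set R) (m : R) : Prop :=
  A m /\ forall y : R, A y -> y <= m.

Definition is_maximizer (R : realType) (D : set R) (f : R -> R) (t0 : R) : Prop :=
  D t0 /\ forall t : R, D t -> f t <= f t0.

Definition delta_fun (R : realType) (n : nat) (z : n.-tuple R[i]) (rho : R) : R :=
  `| \prod_(i < n) (1 - rho * Normc.normc (tnth z i)) |.

(* Main.v *)
Require Import Defs.
From HB Require Import structures.
From mathcomp Require Import all_boot all_order all_algebra.
From mathcomp Require Import complex.
From mathcomp Require Import all_classical all_reals all_analysis.
From mathcomp Require Import lra zify.

Set Implicit Arguments.
Unset Strict Implicit.
Unset Printing Implicit Defensive.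

Import Order.TTheory GRing.Theory Num.Theory.
Import numFieldNormedType.Exports.

Local Open Scope classical_set_scope.
Local Open Scope ring_scope.
Local Open Scope complex_scope.

(** If the null solution is stable, then solutions with small enough x_0 are
    bounded by 1, so there is a bounded solution x with x_0 != 0; this is
    shown to be impossible.

    The classical route divides the generating function 1 - sum a_i t^i by
    its polynomial part and applies Rouche's theorem on the circle of radius
    rho = rho_0.  The argument here only uses the weighted sup norm
    ||u|| = sup_k |u_k| rho^k, which is finite on bounded sequences because
    rho <= 1.  Prepend n zeros to x, calling the result u, and let S be the
    shift (S u)_k = u_(k+1).  For k >= 1 the Volterra equation reads
    (p_n(S) u)_k = sum_(t < k) a_(k+n-t) u_t, which involves only the a_i with
    i > n, so with T = sum_(i > n) |a_i| one gets
    |(p_n(S) u)_k| rho^k <= T ||u|| for every k >= 1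
    ([volterra_poly_shift], [convolution_bound]).

    On the other hand p_n(S) = prod_i (S - z_i), and each factor is bounded
    below: if f_0 = 0 and f is bounded for the weight, the triangle inequality
    gives |1 - rho|z|| ||f|| <= rho ||(S - z) f|| ([factor_bound]).  The
    vanishing of f_0 is provided, for each partial product applied to u, by
    the n leading zeros of u.

    Only the value (p_n(S) u)_0 = x_0 is not controlled by T.  Here the
    instability hypothesis enters: since rho >= 1/r_n and
    delta_n(rho) > T >= 0, a zero z_0 of largest modulus has rho|z_0| > 1, and
    for such an expanding factor, peeled off first, the lower bound needs no
    information at index 0 ([expanding_factor]).  Altogether
    delta_n(rho) ||u|| <= rho^n T ||u|| <= T ||u||, and T < delta_n(rho)
    forces u = 0, hence x_0 = 0 ([no_bounded_solution]). *)

(** * Polynomials in the shift operator *)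

(** The k-th term of p(S) u, where S is the shift. *)
Definition shift_act (C : comNzRingType) (p : {poly C}) (u : nat -> C) (k : nat) : C :=
  \sum_(j < size p) p`_j * u (k + j)%N.

Lemma shift_act_widen (C : comNzRingType) (p : {poly C}) u k N :
  (size p <= N)%N -> shift_act p u k = \sum_(j < N) p`_j * u (k + j)%N.
Proof.
move=> pN; rewrite /shift_act (big_ord_widen N (fun j => p`_j * u (k + j)%N) pN).
rewrite big_mkcond; apply: eq_bigr => j _; case: ltnP => // pj.
by rewrite nth_default ?mul0r.
Qed.

(** Multiplying polynomials composes the operators; this is the only case
    that a product of linear factors calls for. *)
Lemma shift_act_XsubCM (C : comNzRingType) (p : {poly C}) c u k :
  shift_act (('X - c%:P) * p) u k = shift_act p u k.+1 - c * shift_act p u k.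
Proof.
have sz : (size (('X - c%:P) * p)%R <= (size p).+1)%N.
  by apply: leq_trans (size_polyMleq _ _) _; rewrite size_XsubC.
rewrite (shift_act_widen _ _ sz) [in c * _](shift_act_widen _ _ (leqnSn _)).
rewrite mulr_sumr (eq_bigr (fun j : 'I_(size p).+1 =>
  ('X * p)`_j * u (k + j)%N - c * (p`_j * u (k + j)%N))); last first.
  by move=> j _; rewrite mulrBl coefB coefCM mulrBl mulrA.
rewrite sumrB big_ord_recl coefXM /= mul0r add0r; congr (_ - _).
by apply: eq_bigr => j _; rewrite coefXM /= addSnnS.
Qed.

Lemma shift_act1 (C : comNzRingType) (u : nat -> C) k : shift_act 1 u k = u k.
Proof. by rewrite /shift_act size_poly1 big_ord1 coef1 mul1r addn0. Qed.

Lemma shift_act_eq0 (C : comNzRingType) (p : {poly C}) u :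
  (forall j, (j < size p)%N -> u j = 0) -> shift_act p u 0 = 0.
Proof. by move=> u0; apply: big1 => j _; rewrite add0n u0 ?mulr0. Qed.

(** * Lower bounds for one factor S - z *)

Lemma contracting_bound (R : realType) (g : nat -> R) (w B : R) :
  0 <= w -> w < 1 -> 0 <= B -> g 0%N = 0 ->
  (forall k, g k.+1 <= B + w * g k) -> forall k, (1 - w) * g k <= B.
Proof.
move=> w0 w1 B0 g0 gS; elim=> [|k IH]; first by rewrite g0 mulr0.
have := gS k; nra.
Qed.

(** When w > 1 the recursion only bounds each term by the following one, so
    no induction on k can start; boundedness closes the loop, since the
    supremum s satisfies w s <= B + s. *)
Lemma expanding_bound (R : realType) (g : nat -> R) (w B M : R) :
  1 < w -> (forall k, g k <= M) ->
  (forall k, w * g k <= B + g k.+1) -> forall k, (w - 1) * g k <= B.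
Proof.
move=> w1 gM gS k.
have ub : has_ubound (range g) by exists M => _ [j _ <-].
have gsup j : g j <= sup (range g) by apply: ub_le_sup => //; exists j.
have sup_le : sup (range g) <= (B + sup (range g)) / w.
  apply: ge_sup => [|_ [j _ <-]]; first by exists (g 0%N), 0%N.
  by rewrite ler_pdivlMr 1?mulrC; [have := gS j; have := gsup j.+1; lra|lra].
move: sup_le; rewrite ler_pdivlMr; last lra.
have := gsup k; nra.
Qed.

(** Finiteness of the norm sup_k |f_k| rho^k. *)
Definition wbounded (R : realType) (rho : R) (f : nat -> R[i]) : Prop :=
  exists M, forall k, Normc.normc (f k) * rho ^+ k <= M.

Lemma normc_ge0 (R : realType) (x : R[i]) : 0 <= Normc.normc x.
Proof. by case: x => a b; rewrite sqrtr_ge0. Qed.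

Lemma normc_real (R : realType) (x : R) : Normc.normc x%:C = `|x|.
Proof. by rewrite /= expr0n addr0 sqrtr_sqr. Qed.

Lemma normcB_le (R : realType) (x y : R[i]) :
  Normc.normc (x - y) <= Normc.normc x + Normc.normc y.
Proof. by apply: le_trans (le_normcD _ _) _; rewrite normcN. Qed.

Lemma normc_leB (R : realType) (x y : R[i]) :
  Normc.normc x <= Normc.normc (x - y) + Normc.normc y.
Proof. by rewrite -{1}(subrK y x); apply: le_normcD. Qed.

Lemma wbounded_shift_prod (R : realType) (rho : R) (s : seq R[i]) u :
  0 < rho -> wbounded rho u ->
  wbounded rho (shift_act (\prod_(w <- s) ('X - w%:P)) u).
Proof.
move=> rho0 [M uM]; elim: s => [|w s [M' fM]].
  by exists M => k; rewrite big_nil shift_act1.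
exists (M' / rho + Normc.normc w * M') => k; rewrite big_cons shift_act_XsubCM.
set f := shift_act _ _ in fM *.
have rk := exprn_gt0 k rho0.
apply: (@le_trans _ _ ((Normc.normc (f k.+1) + Normc.normc (w * f k)) * rho ^+ k)).
  by rewrite ler_pM2r ?normcB_le.
rewrite Normc.normcM mulrDl -mulrA lerD //.
  by rewrite ler_pdivlMr // -mulrA -exprSr.
by rewrite ler_wpM2l ?normc_ge0.
Qed.

(** At k = 0 the estimate w |f_0| <= |(S - w) f|_0 + |f_1| is trivial because
    f_0 = 0, which is why the hypothesis on (S - w) f can skip index 0. *)
Lemma expanding_factor (R : realType) (rho B : R) (w : R[i]) f :
  0 < rho -> 0 <= B -> 1 < rho * Normc.normc w -> f 0%N = 0 -> wbounded rho f ->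
  (forall k, (0 < k)%N -> Normc.normc (f k.+1 - w * f k) * rho ^+ k <= B) ->
  forall k, (rho * Normc.normc w - 1) * (Normc.normc (f k) * rho ^+ k) <= rho * B.
Proof.
move=> rho0 B0 w1 f0 [M fM] hB.
apply: (expanding_bound w1 fM) => -[|k].
  rewrite f0 Normc.normc0 mul0r mulr0.
  by rewrite addr_ge0 ?mulr_ge0 ?normc_ge0 ?exprn_ge0 // ltW.
have rk := exprn_gt0 k.+1 rho0.
have := ler_wpM2l (ltW rho0) (hB k.+1 isT).
have : Normc.normc (w * f k.+1) * (rho * rho ^+ k.+1) <=
   (Normc.normc (f k.+2 - w * f k.+1) + Normc.normc (f k.+2)) * (rho * rho ^+ k.+1).
  rewrite ler_pM2r ?mulr_gt0 //.
  by rewrite -[f k.+2 - _]opprB (normcN (_ - _ : R[i])) normc_leB.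
rewrite Normc.normcM (exprS rho k.+1).
lra.
Qed.

(** If rho|w| < 1, the bound propagates forward from f_0 = 0; if rho|w| > 1, it
    comes from boundedness. *)
Lemma factor_bound (R : realType) (rho B : R) (w : R[i]) f :
  0 < rho -> f 0%N = 0 -> wbounded rho f ->
  (forall k, Normc.normc (f k.+1 - w * f k) * rho ^+ k <= B) ->
  forall k, `|1 - rho * Normc.normc w| * (Normc.normc (f k) * rho ^+ k) <= rho * B.
Proof.
move=> rho0 f0 fb hB k.
have B0 : 0 <= B.
  by apply: le_trans (hB 0%N); rewrite expr0 mulr1 normc_ge0.
have rw0 : 0 <= rho * Normc.normc w by rewrite mulr_ge0 ?normc_ge0 ?ltW.
case: (ltgtP (rho * Normc.normc w) 1) => [w1|w1|->]; last first.
- by rewrite subrr normr0 mul0r mulr_ge0 // ltW.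
- rewrite ltr0_norm ?subr_lt0 // opprB.
  by apply: expanding_factor.
rewrite gtr0_norm ?subr_gt0 //; move: k.
apply: contracting_bound => //; first by rewrite mulr_ge0 // ltW.
  by rewrite f0 Normc.normc0 mul0r.
move=> k; have rk := exprn_gt0 k rho0.
have := ler_wpM2l (ltW rho0) (hB k).
have : Normc.normc (f k.+1) * (rho * rho ^+ k) <=
   (Normc.normc (f k.+1 - w * f k) + Normc.normc (w * f k)) * (rho * rho ^+ k).
  by rewrite ler_pM2r ?mulr_gt0 // normc_leB.
rewrite Normc.normcM (exprS rho k).
lra.
Qed.

(** * Products of factors *)

(** The factors are removed one at a time. The leading zeros of u ensure that
    every intermediate sequence vanishes at 0, as [factor_bound] requires. *)
Lemma shift_prod_bound (R : realType) (rho B : R) (s : seq R[i]) u :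
  0 < rho -> wbounded rho u -> (forall j, (j < size s)%N -> u j = 0) ->
  (forall k, Normc.normc (shift_act (\prod_(w <- s) ('X - w%:P)) u k) * rho ^+ k <= B) ->
  forall k, \prod_(w <- s) `|1 - rho * Normc.normc w| * (Normc.normc (u k) * rho ^+ k)
    <= rho ^+ size s * B.
Proof.
move=> rho0 ub; elim: s B => [|w s IH] B u0 hB k.
  by have := hB k; rewrite !big_nil shift_act1 !mul1r.
have B0 : 0 <= B.
  by apply: le_trans (hB 0%N); rewrite expr0 mulr1 normc_ge0.
have f0 : shift_act (\prod_(w <- s) ('X - w%:P)) u 0 = 0.
  by apply: shift_act_eq0 => j; rewrite size_prod_XsubC => /u0.
have fB : forall k, `|1 - rho * Normc.normc w| *
    (Normc.normc (shift_act (\prod_(w <- s) ('X - w%:P)) u k) * rho ^+ k) <= rho * B.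
  apply: factor_bound => //; first exact: wbounded_shift_prod.
  by move=> j; have := hB j; rewrite big_cons shift_act_XsubCM.
rewrite big_cons /= exprS.
(* A vanishing factor makes the claim trivial; otherwise divide by it. *)
have [c0|c0] := eqVneq `|1 - rho * Normc.normc w| 0.
  by rewrite c0 !mul0r !mulr_ge0 ?exprn_ge0 // ltW.
have cp : 0 < `|1 - rho * Normc.normc w| by rewrite lt0r c0 normr_ge0.
have /IH : forall j, Normc.normc (shift_act (\prod_(w <- s) ('X - w%:P)) u j)
    * rho ^+ j <= rho * B / `|1 - rho * Normc.normc w|.
  by move=> j; rewrite ler_pdivlMr // mulrC.
move=> /(_ (fun j js => u0 j (ltnW js)) k).
rewrite mulrA ler_pdivlMr //; lra.
Qed.

(** * The Volterra equation as a shift equation *)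

(** The recursion depends on the whole past, so the list of past values is
    iterated. *)
Lemma volterra_solution_exists (R : realType) (a : nat -> R) (c : R) :
  exists2 x, volterra_solution a x & x 0%N = c.
Proof.
pose next s := rcons s (\sum_(0 <= i < size s) a (size s - i)%N * s`_i).
pose hist n := iter n next [:: c].
have size_hist n : size (hist n) = n.+1.
  by elim: n => // n IH; rewrite /= size_rcons IH.
have histE n i : (i <= n)%N -> (hist n)`_i = (hist i)`_i.
  elim: n => [|n IH]; first by rewrite leqn0 => /eqP ->.
  rewrite leq_eqVlt => /predU1P [->//|i_n].
  by rewrite /= nth_rcons size_hist i_n IH.
exists (fun n => (hist n)`_n) => // -[//|n] _.
rewrite /= nth_rcons size_hist ltnn eqxx.
by apply: eq_big_nat => i /andP [_ i_n]; rewrite histE.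
Qed.

Definition delay (R : realType) (n : nat) (x : nat -> R) (k : nat) : R[i] :=
  if (k < n)%N then 0 else (x (k - n)%N)%:C.

Lemma delayE (R : realType) (n : nat) (x : nat -> R) k :
  delay n x (k + n) = (x k)%:C.
Proof. by rewrite /delay ltnNge leq_addl addnK. Qed.

(** The n leading zeros contribute nothing, so the delayed sequence satisfies
    the same convolution equation from index n + 1 on. *)
Lemma delayed_solution (R : realType) (a x : nat -> R) n k :
  volterra_solution a x -> (0 < k)%N ->
  delay n x (k + n) = \sum_(0 <= t < k + n) (a (k + n - t)%N)%:C * delay n x t.
Proof.
move=> ax k0; rewrite delayE ax // [RHS](@big_cat_nat _ _ _ n) ?leq_addl //=.
have head0 : \sum_(0 <= t < n) (a (k + n - t)%N)%:C * delay n x t = 0.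
  rewrite big_nat_cond; apply: big1 => t.
  by rewrite andbT => /andP [_ t_n]; rewrite /delay t_n mulr0.
rewrite head0 add0r -{1}(add0n n) big_addn addnK rmorph_sum /=.
by apply: eq_bigr => t _; rewrite rmorphM delayE /= subnDr.
Qed.

Lemma volterra_polyE (R : realType) (a : nat -> R) n :
  volterra_poly a n = 'X^n - \poly_(j < n) (a (n - j)%N)%:C.
Proof.
rewrite /volterra_poly poly_def; congr (_ - _).
rewrite big_nat_rev big_add1 /= big_mkord; apply: eq_bigr => j _.
by rewrite !add1n !subSS subKn // ltnW.
Qed.

(** The coefficients of p_n cancel the n most recent terms of the
    convolution, leaving only the a_i with i > n. *)
Lemma volterra_poly_shift (R : realType) (a x : nat -> R) n k :
  volterra_solution a x -> (0 < k)%N ->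
  shift_act (volterra_poly a n) (delay n x) k =
  \sum_(0 <= t < k) (a (k + n - t)%N)%:C * delay n x t.
Proof.
move=> ax k0; rewrite volterra_polyE.
have sz : (size ('X^n - \poly_(j < n) (a (n - j)%N)%:C : {poly R[i]})%R <= n.+1)%N.
  rewrite (leq_trans (size_polyD _ _)) // size_polyN size_polyXn geq_max leqnn /=.
  exact: leq_trans (size_poly _ _) (leqnSn _).
rewrite (shift_act_widen _ _ sz) big_ord_recr /= coefB coefXn eqxx coef_poly ltnn.
rewrite subr0 mul1r (delayed_solution n ax k0).
have tailE : \sum_(k <= t < k + n) (a (k + n - t)%N)%:C * delay n x t =
    \sum_(j < n) (a (n - j)%N)%:C * delay n x (k + j).
  rewrite -{1}(add0n k) big_addn addKn big_mkord; apply: eq_bigr => j _.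
  by rewrite (addnC j) subnDl.
rewrite (@big_cat_nat _ _ _ k 0 (k + n)) ?leq_addr //= tailE addrCA.
rewrite -big_split -[RHS]addr0; congr (_ + _); apply: big1 => j _ /=.
rewrite coefB coefXn coef_poly ltn_ord (ltn_eqF (ltn_ord j)) sub0r.
by rewrite mulNr addNr.
Qed.

(** * Bounded solutions vanish *)

Lemma normc_sum_le (R : realType) (I : Type) (r : seq I) (F : I -> R[i]) :
  Normc.normc (\sum_(i <- r) F i) <= \sum_(i <- r) Normc.normc (F i).
Proof.
apply: (big_ind2 (fun x y => Normc.normc x <= y)) => //.
  by rewrite Normc.normc0.
by move=> x1 y1 x2 y2 h1 h2; apply: le_trans (le_normcD _ _) (lerD h1 h2).
Qed.

(** Since rho <= 1 the weight rho^k is at most rho^t for t <= k, so the weight can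
    be moved onto u_t. *)
Lemma convolution_bound (R : realType) (rho S : R) (c : nat -> R) (u : nat -> R[i]) k :
  0 < rho -> rho <= 1 -> (forall t, Normc.normc (u t) * rho ^+ t <= S) ->
  Normc.normc (\sum_(0 <= t < k) (c t)%:C * u t) * rho ^+ k <=
  (\sum_(0 <= t < k) `|c t|) * S.
Proof.
move=> rho0 rho1 uS.
apply: (@le_trans _ _ ((\sum_(0 <= t < k) Normc.normc ((c t)%:C * u t)) * rho ^+ k)).
  by rewrite ler_pM2r ?exprn_gt0 // normc_sum_le.
rewrite !mulr_suml; apply: ler_sum_nat => t /andP [_ t_k].
rewrite Normc.normcM normc_real -mulrA ler_wpM2l //.
apply: le_trans (uS t); rewrite ler_wpM2l ?normc_ge0 //.
by rewrite ler_wiXn2l ?(ltW rho0) // ltnW.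
Qed.

Lemma tail_sum_rev (R : realType) (b : nat -> R) n k :
  \sum_(0 <= t < k) b (k + n - t)%N = \sum_(n.+1 <= i < k + n.+1) b i.
Proof.
rewrite big_nat_rev -[in RHS](add0n n.+1) big_addn add0n addnK.
by apply: eq_big_nat => t /andP [_ t_k]; congr b; lia.
Qed.

(** The factor of z0 is treated apart, as the one that tolerates the unknown
    value x_0 of p_n(S) u at index 0; the remaining factors go through
    [shift_prod_bound]. *)
Lemma no_bounded_solution (R : realType) (a x : nat -> R) (n : nat)
    (zs : seq R[i]) (z0 : R[i]) (rho T M : R) :
  volterra_poly a n = \prod_(w <- zs) ('X - w%:P) ->
  z0 \in zs -> 0 < rho -> rho <= 1 -> 1 < rho * Normc.normc z0 ->
  (forall k, \sum_(n.+1 <= i < k) `|a i| <= T) ->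
  T < \prod_(w <- zs) `|1 - rho * Normc.normc w| ->
  volterra_solution a x -> (forall k, `|x k| <= M) -> x 0%N = 0.
Proof.
move=> pE z0zs rho0 rho1 z0_gt1 aT Tdelta ax xM.
have size_zs : size zs = n.
  have := size_prod_XsubC zs id; rewrite -pE volterra_polyE.
  rewrite size_polyDl ?size_polyXn ?size_polyN ?ltnS ?size_poly //.
  by move=> [].
set u := delay n x.
have M0 : 0 <= M by apply: le_trans (xM 0%N).
have uM k : Normc.normc (u k) * rho ^+ k <= M.
  rewrite /u /delay; case: ifP => _; first by rewrite Normc.normc0 mul0r.
  rewrite normc_real; apply: le_trans (xM (k - n)%N).
  by rewrite ler_piMr // exprn_ile1 // ltW.
pose nu := sup (range (fun k => Normc.normc (u k) * rho ^+ k)).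
have u_nu k : Normc.normc (u k) * rho ^+ k <= nu.
  by apply: ub_le_sup; [exists M => _ [j _ <-] | exists k].
have nu0 : 0 <= nu.
  by apply: le_trans (u_nu 0%N); rewrite mulr_ge0 ?normc_ge0.
have T0 : 0 <= T by have := aT 0%N; rewrite big_geq.
have hT k : (0 < k)%N ->
  Normc.normc (shift_act (volterra_poly a n) u k) * rho ^+ k <= T * nu.
  move=> k0; rewrite volterra_poly_shift //.
  apply: le_trans (convolution_bound (fun t => a (k + n - t)%N) k rho0 rho1 u_nu) _.
  by rewrite ler_wpM2r // (tail_sum_rev (fun i => `|a i|)).
have zsE := perm_to_rem z0zs; set s := rem z0 zs in zsE.
have size_s : (size s < n)%N by rewrite -size_zs (perm_size zsE).
set f := shift_act (\prod_(w <- s) ('X - w%:P)) u.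
have ub : wbounded rho u by exists M.
have fB k : (rho * Normc.normc z0 - 1) * (Normc.normc (f k) * rho ^+ k)
    <= rho * (T * nu).
  move: k; apply: expanding_factor => //.
  - by rewrite mulr_ge0.
  - apply: shift_act_eq0 => j; rewrite size_prod_XsubC ltnS => j_s.
    by rewrite /u /delay (leq_ltn_trans j_s).
  - exact: wbounded_shift_prod.
  by move=> k /hT; rewrite pE (perm_big _ zsE) big_cons shift_act_XsubCM.
have c0 : 0 < rho * Normc.normc z0 - 1 by rewrite subr_gt0.
have /shift_prod_bound : forall k, Normc.normc (f k) * rho ^+ k <=
    rho * (T * nu) / (rho * Normc.normc z0 - 1).
  by move=> k; rewrite ler_pdivlMr // mulrC.
move=> /(_ rho0 ub) uB.
have nuB : \prod_(w <- zs) `|1 - rho * Normc.normc w| * nu <= T * nu.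
  have d0 : 0 < \prod_(w <- zs) `|1 - rho * Normc.normc w| by apply: le_lt_trans T0 _.
  rewrite mulrC -ler_pdivlMr //; apply: ge_sup => [|_ [k _ <-]].
    by exists (Normc.normc (u 0%N) * rho ^+ 0), 0%N.
  rewrite ler_pdivlMr // mulrC (perm_big _ zsE) big_cons /=.
  rewrite ltr0_norm ?subr_lt0 // opprB -mulrA mulrC -ler_pdivlMr //.
  apply: le_trans (uB _ k) _ => [j j_s|].
    by rewrite /u /delay (ltn_trans j_s).
  rewrite mulrA ler_pM2r ?invr_gt0 // mulrA ler_piMl ?mulr_ge0 //.
  by rewrite -exprSr exprn_ile1 // ltW.
have nu_eq0 : nu <= 0.
  rewrite leNgt; apply/negP => nu_gt0; move: nuB; rewrite ler_pM2r //.
  by rewrite leNgt Tdelta.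
have := le_trans (u_nu n) nu_eq0; rewrite pmulr_lle0 ?exprn_gt0 //.
by rewrite /u /delay ltnn subnn normc_real normr_le0 => /eqP.
Qed.

Theorem theorem14 (R : realType) (a : nat -> R) :
  (exists (n : nat) (z : n.-tuple R[i]) (r rho0 : R),
     [/\ (1 <= n)%N,
         volterra_poly a n = \prod_(i < n) ('X - (tnth z i)%:P),
         is_max (root_moduli (volterra_poly a n)) r,
         1 < r &
         is_maximizer `[r^-1, 1] (delta_fun z) rho0 /\
         (\sum_(n.+1 <= i <oo) `|a i|%:E < (delta_fun z rho0)%:E)%E]) ->
  null_solution_unstable a.
Proof.
move=> [n [z [_ [rho [_ pE [[z0 z0root <-] _] r1]]]]] [[rhoI _] tail] stable.
set r := Normc.normc z0 in r1 rhoI.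
have r0 : 0 < r by apply: lt_trans r1.
move: rhoI; rewrite /= in_itv /= => /andP [rho_ge rho1].
have rho0 : 0 < rho by apply: lt_le_trans rho_ge; rewrite invr_gt0.
have pE' : volterra_poly a n = \prod_(w <- z) ('X - w%:P) by rewrite big_tuple.
have z0z : z0 \in z by move: z0root; rewrite /= pE' root_prod_XsubC.
have deltaE : delta_fun z rho = \prod_(w <- z) `|1 - rho * Normc.normc w|.
  by rewrite /delta_fun normr_prod big_tuple.
have abs_ge0 i : (n.+1 <= i)%N -> true -> (0 <= `|a i|%:E)%E by rewrite lee_fin.
have tail_ge0 : (0 <= \sum_(n.+1 <= i <oo) `|a i|%:E)%E by exact: nneseries_ge0.
have tail_fin : (\sum_(n.+1 <= i <oo) `|a i|%:E)%E \is a fin_num.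
  by rewrite ge0_fin_numE // (lt_trans tail) ?ltry.
pose T := fine (\sum_(n.+1 <= i <oo) `|a i|%:E)%E.
have aT k : \sum_(n.+1 <= i < k) `|a i| <= T.
  by rewrite -lee_fin fineK // -sumEFin; apply: nneseries_lim_ge.
have T0 : 0 <= T by apply: fine_ge0.
have Tdelta : T < delta_fun z rho by rewrite -lte_fin fineK.
(* At rho = 1/r the factor of z0, hence delta, would vanish. *)
have rho_r : 1 < rho * r.
  rewrite lt_neqAle -ler_pdivrMr // mul1r rho_ge andbT; apply/eqP => rho_r.
  move: Tdelta; rewrite ltNge deltaE (perm_big _ (perm_to_rem z0z)) big_cons /=.
  by rewrite -/r -rho_r subrr normr0 mul0r T0.
have [d d0 hd] := stable 1 ltr01.
have [x ax x0] := volterra_solution_exists a (d / 2).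
have x_lt1 : forall k, `|x k| < 1.
  by apply: hd => //; rewrite x0 gtr0_norm; lra.
have := no_bounded_solution pE' z0z rho0 rho1 rho_r aT _ ax (fun k => ltW (x_lt1 k)).
by rewrite -deltaE x0 => /(_ Tdelta); lra.
Qed.
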